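(* In the $p$-value model with higher criticism statistic $HC_n$ described in the context, define for $v\in(0,1/2)$ $$H_n(v)=\frac{\bigl|\sum_{i=1}^{k_n}\varepsilon_{n,i}(\mu_{n,i}(0,v]-v)\bigr|+\bigl|\sum_{i=1}^{k_n}\varepsilon_{n,i}(\mu_{n,i}(1-v,1)-v)\bigr|}{\sqrt{k_nv}}.$$ Let $(v_n)_{n\in\mathbb N}$ be a sequence in $(0,1/2)$ such that $a_n^{-1}H_n(v_n)\to\infty$ and $\liminf_{n\to\infty}k_nv_n>0$. Then $a_nHC_n-b_n\to\infty$ in $Q_{(n)}$-probability.
   Context: $k_n\in\mathbb N$, $k_n\to\infty$. All noise distributions $P_{n,i}$ are the uniform distribution on $(0,1)$; $\mu_{n,i}$, $1\le i\le k_n$, are probability measures on $(0,1)$ absolutely continuous with respect to Lebesgue measure; $\varepsilon_{n,i}\in[0,1]$ with $\max_i\varepsilon_{n,i}\to0$. $Q_{n,i}=(1-\varepsilon_{n,i})P_{n,i}+\varepsilon_{n,i}\mu_{n,i}$ and $Q_{(n)}=\bigotimes_{i=1}^{k_n}Q_{n,i}$. The observations $p_{n,1},\dots,p_{n,k_n}$ are the coordinates, $\mathbb F_n$ is their empirical distribution function, and $$HC_n=\sup_{t\in(0,1)}\Bigl|\sqrt{k_n}\,\frac{\mathbb F_n(t)-t}{\sqrt{t(1-t)}}\Bigr|.$$ Normalizing constants (for $n$ large): $a_n=\sqrt{2\log\log k_n}$, $b_n=2\log\log k_n+\frac12\log\log\log k_n-\frac12\log\pi$. ''$X_n\to\infty$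 in $Q_{(n)}$-probability'' means $Q_{(n)}(X_n\le C)\to0$ for every $C\in\mathbb R$. *)

(* Defs.v *)
From HB Require Import structures.
From mathcomp Require Import all_boot all_order all_algebra.
From mathcomp Require Import interval_inference.
From mathcomp Require Import all_classical all_reals all_analysis.

Set Implicit Arguments.
Unset Strict Implicit.
Unset Printing Implicit Defensive.

Import Order.TTheory GRing.Theory Num.Theory.
Import numFieldNormedType.Exports.

Local Open Scope classical_set_scope.
Local Open Scope ring_scope.

Section mixture.
Context d (T : measurableType d) (R : realType).
Variables (e : {i01 R}) (P1 P2 : probability T R).

Definition mixture (A : set T) : \bar R :=
  ((1 - e%:num)%:E * P1 A + e%:num%:E * P2 A)%E.

Let mixture_measure_add :
  mixture = measure_add (mscale (1 - e%:num)%:nng P1) (mscale e%:num%:nng P2).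
Proof. by apply/funext => A; rewrite measure_addE. Qed.

Let mixture0 : mixture set0 = 0%E.
Proof. by rewrite /mixture !measure0 !mule0 adde0. Qed.

Let mixture_ge0 A : (0 <= mixture A)%E.
Proof. by rewrite /mixture adde_ge0// mule_ge0// lee_fin. Qed.

Let mixture_sigma_additive : semi_sigma_additive mixture.
Proof. by rewrite mixture_measure_add; exact: measure_semi_sigma_additive. Qed.

HB.instance Definition _ := isMeasure.Build _ _ _ mixture
  mixture0 mixture_ge0 mixture_sigma_additive.

Let mixture_setT : mixture [set: T] = 1%E.
Proof. by rewrite /mixture !probability_setT !mule1 -EFinD subrK. Qed.

HB.instance Definition _ := Measure_isProbability.Build _ _ _
  mixture mixture_setT.

End mixture.

Section tuple_product.
Context d (T : measurableType d) (R : realType).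

Definition tcons n (x : T * n.-tuple T) : n.+1.-tuple T :=
  [the n.+1.-tuple T of x.1 :: x.2].

Lemma measurable_tcons n : measurable_fun [set: T * n.-tuple T] (@tcons n).
Proof. exact: measurable_cons. Qed.

HB.instance Definition _ n :=
  isMeasurableFun.Build _ _ _ _ (@tcons n) (@measurable_tcons n).

(* The product of finitely many, possibly different, probability measures;
   [tuple_productE] below is its characterization on measurable boxes. *)
Fixpoint tuple_product n :
    ('I_n -> probability T R) -> probability (n.-tuple T) R :=
  match n with
  | 0 => fun=> (@dirac _ (0.-tuple T) [tuple] R : probability _ R)
  | m.+1 => fun Q =>
      distribution (Q ord0 \x tuple_product (fun i => Q (lift ord0 i)))%E
        (@tcons m)
  end.

Lemma tuple_productE n (Q : 'I_n -> probability T R) (A : 'I_n -> set T) :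
  (forall i, measurable (A i)) ->
  tuple_product Q [set x : n.-tuple T | forall i, A i (tnth x i)] =
    (\prod_(i < n) Q i (A i))%E.
Proof.
elim: n Q A => [|n IH] Q A mA.
  by rewrite big_ord0/= diracE mem_set// => -[].
rewrite big_ord_recl/= /distribution /pushforward/=.
rewrite -IH//. set B := (X in (_ * tuple_product _ X)%E).
have mB : measurable B.
  have -> : B = \bigcap_(i in [set: 'I_n]) ((@tnth n T)^~ i @^-1` A (lift ord0 i)).
    by apply/seteqP; split => [x Bx i _|x Bx i]; [exact: Bx|exact: (Bx i I)].
  apply: fin_bigcap_measurable => // i _.
  by rewrite -[X in measurable X]setTI; exact: measurable_tnth.
rewrite -product_measure1E//; congr (_ _).
apply/seteqP; split => -[x t]/=.
  by move=> H; split; [have := H ord0|move=> i; have := H (lift ord0 i); rewrite tnthS].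
move=> -[Ax At] i; case: (unliftP ord0 i) => [j ->|-> //].
by rewrite tnthS; exact: At.
Qed.

End tuple_product.

Section higher_criticism.
Context (R : realType).

(* Probability measures on (0, 1) are represented as probability measures on R
   carried by the interval `]0, 1[. *)
Definition uniform01 : probability (measurableTypeR R) R :=
  uniform_prob (@ltr01 R).

Definition observation_law n (eps : 'I_n -> {i01 R})
    (mu : 'I_n -> probability (measurableTypeR R) R) :
    probability (n.-tuple (measurableTypeR R)) R :=
  tuple_product (fun i => mixture (eps i) uniform01 (mu i)).

Definition empirical_cdf n (p : n.-tuple R) (t : R) : R :=
  n%:R^-1 * \sum_(i < n) \1_`]-oo, t] (tnth p i).

(* The supremum is taken in the extended reals, as it is infinite when some
   observation lies outside of `]0, 1[ (an event of probability zero). *)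
Definition higher_criticism n (p : n.-tuple R) : \bar R :=
  ereal_sup [set `|Num.sqrt n%:R *
      ((empirical_cdf p t - t) / Num.sqrt (t * (1 - t)))|%:E | t in `]0, 1[].

Definition hc_scale (k : nat) : R := Num.sqrt (2 * ln (ln k%:R)).

Definition hc_center (k : nat) : R :=
  2 * ln (ln k%:R) + 2^-1 * ln (ln (ln k%:R)) - 2^-1 * ln pi.

Definition tail_signal n (eps : 'I_n -> {i01 R})
    (mu : 'I_n -> probability (measurableTypeR R) R) (v : R) : R :=
  (`|\sum_(i < n) (eps i)%:num * (fine (mu i `]0%R, v]%classic) - v)| +
   `|\sum_(i < n) (eps i)%:num * (fine (mu i `]1 - v, 1%R[%classic) - v)|)
  / Num.sqrt (n%:R * v).

End higher_criticism.

(* Main.v *)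
(* Fix a tail set A, either (-oo, v] or (1 - v, +oo), and let D be the matching
   signal sum. The number of observations in A has mean k v + D and variance at
   most k v + |D|, whereas HC <= 2 a, which follows from a HC - b <= C for large k,
   keeps this number within 2 a sqrt(k v) of k v. For the tail carrying at least
   half of the signal, |D| / (a sqrt(k v)) tends to infinity, so Chebyshev's
   inequality bounds the probability by 4 (k v + |D|) / D^2, which tends to 0
   since k v stays away from 0. *)
Require Import Defs.
From mathcomp Require Import all_boot all_order all_algebra.
From mathcomp Require Import interval_inference.
From mathcomp Require Import all_classical all_reals all_analysis.
From mathcomp Require Import measurable_realfun.
From mathcomp Require Import ring lra.

Set Implicit Arguments.
Unset Strict Implicit.
Unset Printing Implicit Defensive.

Import Order.TTheory GRing.Theory Num.Theory.
Import numFieldNormedType.Exports.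

Local Open Scope classical_set_scope.
Local Open Scope ring_scope.

(* The integrals of nonnegative functions are suprema over the simple functions
   below them, so they are monotone even without measurability. Hence so are the
   product laws, and the measurability of the event on HC is never needed. *)
Lemma le_integral_nonmeasurable d (T : measurableType d) (R : realType)
    (m : {measure set T -> \bar R}) (f g : T -> \bar R) :
  (forall x, 0 <= f x)%E -> (forall x, f x <= g x)%E ->
  (\int[m]_x f x <= \int[m]_x g x)%E.
Proof.
move=> f0 fg; have g0 x : (0 <= g x)%E by exact: le_trans (fg x).
rewrite !ge0_integralTE//; apply: ereal_sup_le => _ /= [h hf <-].
by exists h => // x; exact: le_trans (fg x).
Qed.

Lemma le_tuple_product d (T : measurableType d) (R : realType) n
    (Q : 'I_n -> probability T R) (A B : set (n.-tuple T)) :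
  A `<=` B -> (tuple_product Q A <= tuple_product Q B)%E.
Proof.
elim: n Q A B => [|n IH] Q A B AB /=.
  rewrite !diracE lee_fin ler_nat.
  by case: (boolP (_ \in A)) => // /set_mem /AB ?; rewrite mem_set.
rewrite /distribution /pushforward /product_measure1/=.
apply: le_integral_nonmeasurable => // x; apply: IH => y.
by rewrite /xsection /= !inE; exact: AB.
Qed.

(** * Chebyshev's inequality for counts of pairwise independent events *)

Section pairwise_independence.
Context d (T : measurableType d) (R : realType) (P : probability T R).
Local Open Scope ereal_scope.

Lemma Lfun2_indic (A : set T) : measurable A -> (\1_A : T -> R) \in Lfun P 2%:E.
Proof.
move=> mA; apply/andP; split; rewrite inE; first exact: measurable_indic.
rewrite /= /finite_norm unlock poweR_lty//.
(* An indicator equals its own square, so integrability of the square reduces to that of the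
   indicator. *)
rewrite (eq_integral (EFin \o \1_A)) => [|x _].
  by apply: integrable_lty => //; exact: integrable_indic.
by rewrite /= indicE; case: (x \in A); rewrite ?normr1 ?powR1// normr0 powR0.
Qed.

Lemma covariance_indic (A B : set T) : measurable A -> measurable B ->
  covariance P \1_A \1_B = P (A `&` B) - P A * P B.
Proof.
move=> mA mB; have Pfin : P setT \is a fin_num by exact: fin_num_measure.
rewrite covarianceE ?Lfun2_mul_Lfun1 ?(Lfun_subset12 Pfin) ?Lfun2_indic//.
have -> : (\1_A * \1_B)%R = \1_(A `&` B) :> (T -> R) by rewrite indicI.
by rewrite !expectation_indic//; exact: measurableI.
Qed.

(** Bienaymé's identity: by bilinearity the covariance of one term with the sum of the others
    vanishes, so the variance splits off one term at a time. *)
Lemma variance_sum (I : eqType) (s : seq I) (X : I -> T -> R) :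
  uniq s -> (forall i, X i \in Lfun P 2%:E) ->
  (forall i j, i != j -> covariance P (X i) (X j) = 0) ->
  'V_P[(\sum_(i <- s) X i)%R] = \sum_(i <- s) 'V_P[X i].
Proof.
move=> us X2 Xcov.
have S2 t : (\sum_(i <- t) X i)%R \in Lfun P 2%:E.
  by rewrite rpred_sum ?lee1n//= => _ i _; exact: X2.
have cov0 j t : j \notin t -> covariance P (X j) (\sum_(i <- t) X i)%R = 0.
  elim: t => [|i t IH] => [_|]; first by rewrite big_nil covariance_cst_r.
  rewrite inE negb_or => /andP[ji jt].
  by rewrite big_cons covarianceDr// Xcov// IH// adde0.
elim: s us => [|j s IH] /=; first by rewrite !big_nil variance_cst.
move=> /andP[js us]; rewrite !big_cons varianceD// cov0// IH//.
by rewrite mule0 adde0.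
Qed.

(** An indicator of probability p has variance p - p^2 <= p. Hence the variance of the count is at
    most its mean, which takes its place in Chebyshev's inequality. *)
Lemma chebyshev_count n (E : 'I_n -> set T) (r : R) :
  (forall i, measurable (E i)) ->
  (forall i j, i != j -> P (E i `&` E j) = P (E i) * P (E j)) ->
  (0 < r)%R ->
  P [set x | r <= `|\sum_(i < n) \1_(E i) x - \sum_(i < n) fine (P (E i))|]%R <=
    (r ^- 2 * \sum_(i < n) fine (P (E i)))%:E.
Proof.
move=> mE indE r0.
have fE i : (fine (P (E i)))%:E = P (E i) by rewrite fineK// fin_num_measure.
pose X i : T -> R := \1_(E i).
pose S : T -> R := (\sum_(i <- index_enum 'I_n) X i)%R.
have SE x : S x = (\sum_(i < n) \1_(E i) x)%R by rewrite /S fct_sumE.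
have X2 i : X i \in Lfun P 2%:E by exact: Lfun2_indic.
have mS : measurable_fun [set: T] S.
  by rewrite (_ : S = fun x => (\sum_(i < n) \1_(E i) x)%R); [
    apply: measurable_sum => i; exact: measurable_indic | exact/funext].
pose SRV : {RV P >-> R} := mfun_Sub (mem_set mS).
have ES : 'E_P[S] = (\sum_(i < n) fine (P (E i)))%:E.
  rewrite /S -(big_map X xpredT id) expectation_sum; last first.
    by move=> _ /mapP[i _ ->]; apply: Lfun_subset12 => //; exact: fin_num_measure.
  by rewrite big_map -sumEFin; apply: eq_bigr => i _; rewrite expectation_indic.
have := @chebyshev _ _ _ P SRV r r0; rewrite /= ES /=.
under eq_set do rewrite SE.
move=> /le_trans; apply.
rewrite EFinM lee_pmul2l ?fin_numE// ?lte_fin ?invr_gt0 ?exprn_gt0//.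
rewrite /S variance_sum//; last 2 first.
  exact: index_enum_uniq.
  by move=> i j ij; rewrite covariance_indic// indE// subee// fin_numM// fin_num_measure.
rewrite -sumEFin; apply: lee_sum => i _.
rewrite /variance covariance_indic// setIid fE leeBlDr ?fin_numM ?fin_num_measure//.
by rewrite leeDl// mule_ge0.
Qed.

End pairwise_independence.

(** * Events on one or two coordinates of a product law *)

Section tuple_product_events.
Context d (T : measurableType d) (R : realType) (n : nat).
Variable Q : 'I_n -> probability T R.

Lemma tuple_product_tnth (A : set T) i : measurable A ->
  tuple_product Q [set x : n.-tuple T | A (tnth x i)] = Q i A.
Proof.
move=> mA.
(* The event is a box whose other sides are the whole space, each contributing a factor 1. *)
pose B l := if l == i then A else [set: T].
have -> : [set x : n.-tuple T | A (tnth x i)] =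
          [set x : n.-tuple T | forall l, B l (tnth x l)].
  apply/seteqP; split => x /=.
    by move=> Ax l; rewrite /B; case: eqP => // ->.
  by move/(_ i); rewrite /B eqxx.
rewrite tuple_productE; last by move=> l; rewrite /B; case: ifP.
rewrite (bigD1 i)//= {1}/B eqxx big1 ?mule1// => l /negbTE li.
by rewrite /B li probability_setT.
Qed.

Lemma tuple_product_tnthI (A : set T) i j : measurable A -> i != j ->
  (tuple_product Q ([set x : n.-tuple T | A (tnth x i)] `&`
                    [set x : n.-tuple T | A (tnth x j)]) = Q i A * Q j A)%E.
Proof.
move=> mA ij.
pose B l := if l \in pred2 i j then A else [set: T].
have -> : [set x : n.-tuple T | A (tnth x i)] `&`
          [set x : n.-tuple T | A (tnth x j)] =
          [set x : n.-tuple T | forall l, B l (tnth x l)].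
  apply/seteqP; split => x /=.
    by move=> [Ai Aj] l; rewrite /B inE; case: eqP => [->|_] //=; case: eqP => // ->.
  by move=> AB; have := AB i; have := AB j; rewrite /B !inE !eqxx orbT.
rewrite tuple_productE; last by move=> l; rewrite /B; case: ifP.
rewrite (bigD1 i)//= (bigD1 j)//=; last by rewrite eq_sym.
rewrite {1 2}/B !inE !eqxx orbT/= big1 ?mule1// => l /andP[/negbTE li /negbTE lj].
by rewrite /B inE li lj probability_setT.
Qed.

End tuple_product_events.

(** * Laws carried by the unit interval *)

Section laws_on_unit_interval.
Context (R : realType).

(** The complement of [S] is null, so only the traces on [S] count. This exchanges the bounded
    intervals of [tail_signal] for the half-lines on which observations are counted. *)
Lemma carried_subset d (T : measurableType d) (P : probability T R)
    (A B S : set T) :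
  measurable A -> measurable B -> measurable S -> P S = 1%E ->
  A `&` S = B `&` S -> P A = P B.
Proof.
move=> mA mB mS PS AB.
have PCS : P (~` S) = 0%E by rewrite probability_setC// PS subee.
have PI C : measurable C -> P C = P (C `&` S).
  move=> mC; rewrite -[in LHS](setIT C) -(setUv S) setIUr measureU0//.
  - exact: measurableI.
  - by apply: measurableI => //; exact: measurableC.
  - apply: (subset_measure0 _ _ _ PCS); [|exact: measurableC|exact: subIsetr].
    by apply: measurableI => //; exact: measurableC.
by rewrite PI// AB -PI.
Qed.

Lemma uniform01_le (t : R) : 0 <= t <= 1 -> uniform01 R `]-oo, t]%classic = t%:E.
Proof.
move=> /andP[t0 t1]; rewrite /uniform01 /= /uniform_prob integral_uniform_pdf.
have -> : `]-oo, t]%classic `&` `[0, 1]%classic = `[0, t]%classic :> set R.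
  apply/seteqP; split => x /=; rewrite !in_itv /=.
    by move=> [-> /andP[->]].
  by move=> /andP[-> xt]; rewrite xt (le_trans xt).
rewrite (eq_integral (cst 1%E)) => [|x]; last first.
  rewrite inE /= in_itv /= => /andP[x0 xt].
  by rewrite /uniform_pdf x0 (le_trans xt)//= subr0 invr1.
rewrite integral_cst//= mul1e lebesgue_measure_itv /= lte_fin sube0.
(* The length formula tests whether 0 < t; the degenerate interval t = 0 has length 0 = t. *)
by case: ltgtP t0 => // <-.
Qed.

Lemma uniform01_gt (t : R) : 0 <= t <= 1 -> uniform01 R `]t, +oo[%classic = (1 - t)%:E.
Proof.
move=> t01; have -> : `]t, +oo[%classic = ~` `]-oo, t]%classic :> set R.
  by rewrite setCitvl.
by rewrite probability_setC// uniform01_le.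
Qed.
End laws_on_unit_interval.

(** * Bounds on the higher criticism event for a fixed sample size *)

Section higher_criticism_event.
Context (R : realType).

(** The i-th observation falls in [A] with probability q + eps_i (mu_i(A) - q), so the count has
    mean n q + D. A count within |D|/2 of n q is at least |D|/2 away from this mean, and Chebyshev's
    inequality applies with that radius. *)
Lemma observation_count n (eps : 'I_n -> {i01 R})
    (mu : 'I_n -> probability (measurableTypeR R) R)
    (A : set (measurableTypeR R)) (q : R) (D : R) :
  measurable A -> uniform01 R A = q%:E ->
  D = \sum_(i < n) (eps i)%:num * (fine (mu i A) - q) -> D != 0 ->
  (observation_law eps mu
     [set p | `|\sum_(i < n) \1_A (tnth p i) - n%:R * q| <= `|D| / 2]%R <=
   (4 * (n%:R * q + `|D|) / D ^+ 2)%:E)%E.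
Proof.
move=> mA unifA DE D0.
pose E i : set (n.-tuple (measurableTypeR R)) := [set p | A (tnth p i)].
have r0 : 0 < `|D| / 2 by rewrite divr_gt0// normr_gt0.
have PE i : observation_law eps mu (E i) =
    (q + (eps i)%:num * (fine (mu i A) - q))%:E.
  transitivity ((1 - (eps i)%:num)%:E * uniform01 R A + (eps i)%:num%:E * mu i A)%E.
    by rewrite /observation_law tuple_product_tnth.
  rewrite unifA.
  rewrite -[X in (_ + _ * X)%E]fineK ?fin_num_measure// -!EFinM -EFinD.
  by congr EFin; ring.
have sumE : \sum_(i < n) fine (observation_law eps mu (E i)) = n%:R * q + D.
  under eq_bigr do rewrite PE/=.
  by rewrite big_split/= sumr_const card_ord -DE mulr_natl.
have mE i : measurable (E i).
  by rewrite -[E i]setTI; exact: measurable_tnth.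
have indE i j : i != j -> (observation_law eps mu (E i `&` E j) =
    observation_law eps mu (E i) * observation_law eps mu (E j))%E.
  by move=> ij; rewrite /observation_law tuple_product_tnthI// !tuple_product_tnth.
have := chebyshev_count mE indE r0; rewrite sumE => cheb.
apply: le_trans (le_trans (le_tuple_product _ _) cheb) _.
- move=> p; rewrite /mkset.
  have -> : \sum_(i < n) \1_(E i) p = \sum_(i < n) \1_A (tnth p i) :> R.
    by [].
  set S := \sum_(i < n) _.
  move=> Sq; have : `|D| <= `|S - (n%:R * q + D)| + `|S - n%:R * q|.
    rewrite addrC -[X in `|X| <= _](_ : (S - n%:R * q) - (S - (n%:R * q + D)) = D).
      exact: ler_normB.
    by ring.
  lra.
- rewrite lee_fin exprMn exprVn real_normK ?num_real//.
  rewrite (_ : (D ^+ 2 / 2 ^+ 2)^-1 * _ = 4 * (n%:R * q + D) / D ^+ 2); last first.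
    by field.
  rewrite ler_pM2r ?invr_gt0 ?exprn_even_gt0//.
  by rewrite ler_pM2l// lerD2l ler_norm.
Qed.

Lemma higher_criticism_le n (p : n.-tuple R) (h t : R) : (0 < n)%N ->
  0 < t < 1 -> (higher_criticism p <= h%:E)%E ->
  `|\sum_(i < n) \1_`]-oo, t] (tnth p i) - n%:R * t| <=
    h * Num.sqrt (n%:R * (t * (1 - t))).
Proof.
move=> n0 t01 hch; have n0R : 0 < n%:R :> R by rewrite ltr0n.
have s0 : 0 < Num.sqrt (t * (1 - t)).
  by rewrite sqrtr_gt0; nra.
have sn0 : 0 < Num.sqrt (n%:R : R) by rewrite sqrtr_gt0.
have : ((`|Num.sqrt n%:R * ((empirical_cdf p t - t) / Num.sqrt (t * (1 - t)))|)%:E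
         <= h%:E)%E.
  by apply: le_trans hch; apply: ereal_sup_ubound; exists t => //=; rewrite in_itv.
rewrite lee_fin /empirical_cdf; set S := \sum_(i < n) _.
rewrite !normrM normfV (gtr0_norm s0) (gtr0_norm sn0) mulrA ler_pdivrMr// => H.
have -> : S - n%:R * t = n%:R * (n%:R^-1 * S - t) by field; rewrite gt_eqF.
rewrite normrM gtr0_norm// sqrtrM ?ler0n// mulrCA.
(* Write n as sqrt n * sqrt n and cancel one factor. *)
rewrite -{1}(sqr_sqrtr (ltW n0R)) expr2 -mulrA.
by rewrite ler_pM2l.
Qed.

(** The right tail is the complement of []-oo, 1 - v]], so its deviation is minus the one at t = 1 -
    v, where t (1 - t) is again v (1 - v). The factor 1 - v <= 1 is dropped. *)
Lemma higher_criticism_tails n (p : n.-tuple R) (h v : R) : (0 < n)%N ->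
  0 < v < 2^-1 -> 0 <= h -> (higher_criticism p <= h%:E)%E ->
  `|\sum_(i < n) \1_`]-oo, v] (tnth p i) - n%:R * v| <= h * Num.sqrt (n%:R * v) /\
  `|\sum_(i < n) \1_`]1 - v, +oo[ (tnth p i) - n%:R * v| <=
    h * Num.sqrt (n%:R * v).
Proof.
move=> n0 v01 h0 hch; have n0R : 0 < n%:R :> R by rewrite ltr0n.
have wv : h * Num.sqrt (n%:R * (v * (1 - v))) <= h * Num.sqrt (n%:R * v).
  apply: ler_wpM2l => //; apply: ler_wsqrtr.
  by rewrite ler_pM2l//; nra.
split; first by apply: le_trans (higher_criticism_le n0 _ hch) wv; lra.
have -> : \sum_(i < n) \1_`]1 - v, +oo[ (tnth p i) - n%:R * v =
    - (\sum_(i < n) \1_`]-oo, 1 - v] (tnth p i) - n%:R * (1 - v)) :> R.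
  have -> : \sum_(i < n) \1_`]1 - v, +oo[ (tnth p i) =
      \sum_(i < n) (1 - \1_`]-oo, 1 - v] (tnth p i)) :> R.
    apply: eq_bigr => i _; rewrite -setCitvl indicC indicE.
    by case: (_ \in _); rewrite ?subrr ?subr0.
  by rewrite big_split/= sumrN sumr_const card_ord -[1 *+ n]/n%:R; ring.
have v1 : 0 < 1 - v < 1 by lra.
rewrite normrN; apply: le_trans (higher_criticism_le n0 v1 hch) _.
by rewrite (_ : 1 - (1 - v) = v) 1?[_ * v]mulrC//; ring.
Qed.

(** To be used with s = sqrt (n v) and D the absolute signal of a tail. The left side is 4 (s / D)^2
    + 4 / D; since D >= B s / 2, the terms are at most 16 / B^2 <= 16 / B and 8 / (B s). *)
Lemma chebyshev_bound (s B D : R) : 0 < s -> 1 <= B -> B * s / 2 <= D ->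
  4 * (s ^+ 2 + D) / D ^+ 2 <= (16 + 8 / s) / B.
Proof.
move=> s0 B1 BD; have B0 : 0 < B by lra.
have Bs0 : 0 < B * s by rewrite mulr_gt0.
have D0 : 0 < D by lra.
have -> : 4 * (s ^+ 2 + D) / D ^+ 2 = 4 * (s / D) ^+ 2 + 4 / D.
  by field; rewrite gt_eqF.
have -> : (16 + 8 / s) / B = 16 / B + 8 / (B * s).
  by field; rewrite !gt_eqF.
apply: lerD.
  have sD : s / D <= 2 / B.
    by rewrite ler_pdivrMr// mulrAC ler_pdivlMr//; lra.
  have sD0 : 0 <= s / D by rewrite divr_ge0// ltW.
  have VB1 : B^-1 <= 1 by rewrite invf_le1.
  have VB0 : 0 < B^-1 by rewrite invr_gt0.
  have : (s / D) ^+ 2 <= (2 / B) ^+ 2 by rewrite ler_sqr ?nnegrE// (le_trans sD0).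
  nra.
by rewrite ler_pdivrMr// mulrAC ler_pdivlMr//; lra.
Qed.

(* One of the two tails carries at least half of the signal, and there the
   count deviates from its mean by a large multiple of its standard
   deviation. *)
Lemma observation_higher_criticism n (eps : 'I_n -> {i01 R})
    (mu : 'I_n -> probability (measurableTypeR R) R) (v a b C B : R) :
  (0 < n)%N -> (forall i, mu i `]0%R, 1%R[%classic = 1%E) -> 0 < v < 2^-1 ->
  1 <= a -> b + C <= 2 * a ^+ 2 -> 8 <= B -> a * B <= tail_signal eps mu v ->
  (observation_law eps mu
     [set p | (a%:E * higher_criticism p - b%:E <= C%:E)%E] <=
   ((16 + 8 / Num.sqrt (n%:R * v)) / B)%:E)%E.
Proof.
move=> n0 mu01 v01 a1 bC B8 aB.
have n0R : 0 < n%:R :> R by rewrite ltr0n.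
have a0 : 0 < a by lra.
set s := Num.sqrt (n%:R * v); have s0 : 0 < s.
  by rewrite sqrtr_gt0 mulr_gt0//; lra.
have s2 : s ^+ 2 = n%:R * v by rewrite sqr_sqrtr// mulr_ge0//; lra.
(* On the event, a HC <= b + C <= 2 a^2, and a > 0 can be divided out; an infinite supremum is
   excluded. *)
have hcP (p : n.-tuple R) : (a%:E * higher_criticism p - b%:E <= C%:E)%E ->
    (higher_criticism p <= (2 * a)%:E)%E.
  case: (higher_criticism p) => [h| |].
  - rewrite -EFinM -EFinB !lee_fin => hC.
    by rewrite -(ler_pM2l a0); lra.
  - by rewrite mulry gtr0_sg// mul1e addye// leye_eq.
  - by rewrite leNye.
have tail (A : set (measurableTypeR R)) D : measurable A ->
    uniform01 R A = v%:E ->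
    D = \sum_(i < n) (eps i)%:num * (fine (mu i A) - v) ->
    a * B * s / 2 <= `|D| ->
    (forall p : n.-tuple R, (higher_criticism p <= (2 * a)%:E)%E ->
      `|\sum_(i < n) \1_A (tnth p i) - n%:R * v| <= 2 * a * s) ->
    (observation_law eps mu
       [set p | (a%:E * higher_criticism p - b%:E <= C%:E)%E] <=
     ((16 + 8 / s) / B)%:E)%E.
  move=> mA uA DE BD dev.
  have aBs : 0 < a * s by rewrite mulr_gt0.
  (* This is where B >= 8 enters: the allowed deviation 2 a s is then at most |D| / 2. *)
  have D8 : 4 * (a * s) <= `|D| by nra.
  have D0 : D != 0 by rewrite -normr_gt0; lra.
  apply: le_trans (le_tuple_product _ _) (le_trans (observation_count mA uA DE D0) _).
    by move=> p /= /hcP /dev; rewrite /=; lra.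
  (* Since a >= 1, the lower bound a B s / 2 on |D| yields the required B s / 2. *)
  rewrite lee_fin -s2 -(real_normK (num_real D)); apply: chebyshev_bound => //.
    by lra.
  by nra.
pose D1 := \sum_(i < n) (eps i)%:num * (fine (mu i `]0%R, v]%classic) - v).
pose D2 := \sum_(i < n) (eps i)%:num * (fine (mu i `]1 - v, 1%R[%classic) - v).
have D12 : a * B * s <= `|D1| + `|D2| by rewrite -ler_pdivlMr.
have [D1B|D1B] := leP (a * B * s / 2) `|D1|.
  apply: (tail `]-oo, v]%classic D1) => //.
  - by rewrite uniform01_le//; lra.
  - apply: eq_bigr => i _; congr (_ * (fine _ - _)).
    apply: (carried_subset _ _ _ (mu01 i)) => //.
    by apply/seteqP; split => x /=; rewrite !in_itv/= => -[h1 h2]; lra.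
  - by move=> p hp; have [] := higher_criticism_tails n0 v01 _ hp => //; lra.
have D2B : a * B * s / 2 <= `|D2| by lra.
apply: (tail `]1 - v, +oo[%classic D2) => //.
- by rewrite uniform01_gt ?subKr//; lra.
- apply: eq_bigr => i _; congr (_ * (fine _ - _)).
  apply: (carried_subset _ _ _ (mu01 i)) => //.
  by apply/seteqP; split => x /=; rewrite !in_itv/= ?andbT => -[h1 h2]; lra.
- by move=> p hp; have [] := higher_criticism_tails n0 v01 _ hp => //; lra.
Qed.

End higher_criticism_event.

(** * Asymptotics in n and the conclusion *)

(** The lower limit is the supremum of the tail infima, so one of these is positive. It is finite,
    being at most a term of the sequence, and serves as c. *)
Lemma limn_einf_gt0 (R : realType) (u : R^nat) :
  (0 < limn_einf (fun n => (u n)%:E))%E ->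
  exists2 c : R, 0 < c & \forall n \near \oo, c <= u n.
Proof.
rewrite limn_einf_lim (cvg_lim _ (@cvg_einfs_sup _ _))//.
move=> /ereal_sup_gt[_ [N _ <-]] infN.
have le_inf n : (N <= n)%N -> (einfs (fun n => (u n)%:E) N <= (u n)%:E)%E.
  by move=> Nn; apply: ereal_inf_lbound; exists n.
case: (einfs _ N) infN le_inf => [c c0 cu|_ cu|//].
  by exists c => //; exists N => // n /cu; rewrite lee_fin.
by have := cu N (leqnn N); rewrite leye_eq.
Qed.

Lemma cvg_lnln (R : realType) (k : nat -> nat) :
  k @ \oo --> \oo -> ln (ln ((k n)%:R : R)) @[n --> \oo] --> +oo.
Proof.
move=> /(@cvgrnyP R) koo; apply/cvgryPge => M.
have /cvgryPge/(_ (expR (expR M))) := koo; apply: filterS => n kM.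
have k0 : 0 < (k n)%:R :> R by exact: lt_le_trans kM.
have lnk : expR M <= ln (k n)%:R by rewrite -ler_expR lnK.
by rewrite -ler_expR lnK// posrE (lt_le_trans _ lnk)// expR_gt0.
Qed.

(** With L = log log k, the right side is 4 L, while ln L < L, ln pi >= 0 and C <= L bound the left
    side by 2 L + L / 2 + L. *)
Lemma hc_center_le (R : realType) (k : nat) (C : R) :
  1 <= ln (ln (k%:R : R)) -> C <= ln (ln (k%:R : R)) ->
  hc_center R k + C <= 2 * hc_scale R k ^+ 2.
Proof.
rewrite /hc_center /hc_scale => L1 LC.
rewrite sqr_sqrtr; last lra.
set L := ln (ln k%:R).
have lnL : ln L < L by apply: ln_sublinear; rewrite /L; lra.
have lnpi : 0 <= ln pi :> R by apply/ln_ge0/le_trans/pi_ge2; lra.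
rewrite -/L in L1 LC; lra.
Qed.

Theorem theorem3p1 (R : realType) (k : nat -> nat)
    (eps : forall n : nat, 'I_(k n) -> {i01 R})
    (mu : forall n : nat, 'I_(k n) -> probability (measurableTypeR R) R)
    (v : nat -> R) :
  k @ \oo --> \oo ->
  (forall (n : nat) (i : 'I_(k n)), mu n i `]0%R, 1%R[%classic = 1%E) ->
  (forall (n : nat) (i : 'I_(k n)), mu n i `<< @lebesgue_measure R) ->
  (\big[Num.max/0]_(i < k n) (eps n i)%:num) @[n --> \oo] --> (0 : R) ->
  (forall n : nat, 0 < v n < 2^-1) ->
  (hc_scale R (k n))^-1 * tail_signal (eps n) (mu n) (v n) @[n --> \oo]
    --> +oo ->
  (0 < limn_einf (fun n => ((k n)%:R * v n)%:E))%E ->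
  forall C : R,
    observation_law (eps n) (mu n)
      [set p | ((hc_scale R (k n))%:E * higher_criticism p
                - (hc_center R (k n))%:E <= C%:E)%E] @[n --> \oo]
    --> 0%E.
Proof.
move=> koo mu01 _ _ v01 signal_oo kv_liminf C.
have [c c0 kv_c] := limn_einf_gt0 kv_liminf.
have loglog_oo := cvg_lnln (R := R) koo.
pose B n : R := (hc_scale R (k n))^-1 * tail_signal (eps n) (mu n) (v n).
have B_oo : B n @[n --> \oo] --> +oo by exact: signal_oo.
have VB0 : (B n)^-1 @[n --> \oo] --> (0 : R).
  by apply/gtr0_cvgV0 => //; move/cvgryPgt: B_oo; exact.
have bound0 : ((16 + 8 / Num.sqrt c) / B n)%:E @[n --> \oo] --> (0%:E : \bar R).
  apply: cvg_EFin; first exact: nearW.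
  by rewrite -[0 in X in _ --> X](mulr0 (16 + 8 / Num.sqrt c)); exact: cvgMr.
(* Eventually k v >= c, so sqrt c may replace sqrt (k v) in the bound for fixed n, leaving a
   constant divided by [B n]. *)
apply: (squeeze_cvge _ (cvg_cst 0%E) bound0).
near=> n; rewrite measure_ge0/=.
have L1 : 1 <= ln (ln (k n)%:R) :> R.
  by near: n; move/cvgryPge: loglog_oo; exact.
have LC : C <= ln (ln (k n)%:R).
  by near: n; move/cvgryPge: loglog_oo; exact.
have B8 : 8 <= B n by near: n; move/cvgryPge: B_oo; exact.
have kvc : c <= (k n)%:R * v n by near: n.
(* An empty sample would give k v = 0 < c. *)
have k0 : (0 < k n)%N.
  by rewrite lt0n; apply/eqP => k0; move: kvc; rewrite k0 mul0r; lra.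
have a1 : 1 <= hc_scale R (k n).
  by rewrite /hc_scale -[leLHS]sqrtr1 ler_wsqrtr//; lra.
have aB : hc_scale R (k n) * B n <= tail_signal (eps n) (mu n) (v n).
  by rewrite /B mulVKf// gt_eqF//; lra.
apply: le_trans (observation_higher_criticism k0 (mu01 n) (v01 n) a1
  (hc_center_le L1 LC) B8 aB) _.
rewrite lee_fin ler_pM2r ?invr_gt0; last lra.
rewrite lerD2l ler_pM2l// lef_pV2 ?posrE ?sqrtr_gt0//; last lra.
exact: ler_wsqrtr.
Unshelve. all: by end_near. Qed.
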